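(* Let $n\ge1$ and $1\le k\le 2n$ be integers, let $m=\lfloor n/2\rfloor$, and suppose $k=3s$ for an integer $s$ and $\frac{9}{4}m<k<3m$. Let $U=\{u_1,\dots,u_n\}$, $V=\{v_1,\dots,v_n\}$ be the parts of $K_{n,n}$, and let $X^{u}_{n,k}\subseteq\mathbb{R}^{n^2}$ be the set of all vectors $x$ with $x_{i,j}=1$ if $u_i\in A$ and $v_j\in B$, $x_{i,j}=0$ otherwise, where $A\subseteq U$, $B\subseteq V$ range over all pairs with $|A|+|B|=k$. For $x\in X^u_{n,k}$ let $$K^{\min}_{n,k}(x)=\{c\in\mathbb{R}^{n^2}_{+}:\ \langle c,x\rangle\le\langle c,y\rangle\ \text{for all } y\in X^u_{n,k}\},$$ and let the graph of the cone decomposition $K^{\min}_{n,k}$ have these cones as vertices, two cones $K^{\min}_{n,k}(x)$, $K^{\min}_{n,k}(y)$ ($x\neq y$) being adjacent iff $\dim\big(K^{\min}_{n,k}(x)\cap K^{\min}_{n,k}(y)\big)=n^2-1$. Then the clique number of this graph satisfies $$\omega(K^{\min}_{n,k})\ \ge\ \binom{m}{s}=\Omega\!\left(\left\lfloor\frac{3n}{2k}\right\rfloor^{k/3}\right).$$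
   Context: $\mathbb{R}^{d}_{+}$ denotes the nonnegative orthant. The clique number of a graph is the maximum size of a set of pairwise adjacent vertices. *)

(* Defs.v *)
From mathcomp Require Import all_boot all_order all_algebra.
From mathcomp Require Import finmap.
From mathcomp Require Import boolp classical_sets reals.

Set Implicit Arguments.
Unset Strict Implicit.
Unset Printing Implicit Defensive.

Import Order.TTheory GRing.Theory Num.Theory.
Local Open Scope fset_scope.
Local Open Scope classical_set_scope.
Local Open Scope ring_scope.

Definition affine_hull (R : fieldType) (V : vectType R) (S : set V) : set V :=
  [set v | exists r (a : 'I_r -> R) (p : 'I_r -> V),
     [/\ forall i, S (p i), \sum_i a i = 1 & v = \sum_i a i *: p i]].

(* The dimension of a convex set is that of its affine hull v0 + W; the empty
   set has no dimension. *)
Definition has_dim (R : fieldType) (V : vectType R) (S : set V) (d : nat) :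
    Prop :=
  exists (v0 : V) (W : {vspace V}),
    affine_hull S = [set v | v - v0 \in W] /\ \dim W = d.

(* Loops of [e], if any, are irrelevant. *)
Definition is_clique (T : finType) (e : rel T) (S : {set T}) : bool :=
  [forall x in S, forall y in S, (x != y) ==> e x y].

Definition clique_number (T : finType) (e : rel T) : nat :=
  (\max_(S : {set T} | is_clique e S) #|S|)%N.

(* R^(n^2) is 'M[R]_n, the coordinate (i, j) being the edge u_i v_j of K_{n,n};
   both parts are indexed by 'I_n. *)
Definition biclique_vec (R : realType) (n : nat) (A B : {set 'I_n}) : 'M[R]_n :=
  \matrix_(i, j) ((i \in A) && (j \in B))%:R.

Definition Xu (R : realType) (n k : nat) : {fset 'M[R]_n} :=
  [fset biclique_vec R P.1 P.2 |
    P in [pred P : {set 'I_n} * {set 'I_n} | (#|P.1| + #|P.2|)%N == k]].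

Definition inner (R : realType) (n : nat) (c x : 'M[R]_n) : R :=
  \sum_i \sum_j c i j * x i j.

Definition Kmin (R : realType) (n k : nat) (x : 'M[R]_n) : set 'M[R]_n :=
  [set c : 'M[R]_n | (forall i j, 0 <= c i j) /\
           (forall y, y \in Xu R n k -> inner c x <= inner c y)].

Definition Kmin_cones (R : realType) (n k : nat) : {fset set 'M[R]_n} :=
  [fset Kmin k x | x in Xu R n k].

Definition Kmin_adj (R : realType) (n k : nat) : rel (Kmin_cones R n k) :=
  fun C D => `[< exists x y : 'M[R]_n,
    [/\ x \in Xu R n k, y \in Xu R n k & x != y] /\
    [/\ val C = Kmin k x, val D = Kmin k y &
        has_dim (Kmin k x `&` Kmin k y) (n ^ 2 - 1)%N] >].

Definition omega_Kmin (R : realType) (n k : nat) : nat :=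
  clique_number (@Kmin_adj R n k).

(* Main.v *)
(** View the vertices of K_{n,n} so that U contains two copies and V one copy of
  {1, ..., m}. An s-subset S gives the biclique x_S spanned by both copies of S in
  U and the copy of S in V; it has 3s vertices. For S <> T with |S \ T| = d, the
  assumption 9m/4 < 3s gives 3d < s. Give the edges outside x_S and x_T a huge
  weight, the edges from the part of U in exactly one of the two bicliques to the
  common part of V a large weight L, and the remaining edges weight 1. Then x_S
  and x_T tie at L * 2d(s - d) plus a lower order term, while any other 3s-vertex
  biclique of moderate cost lies over b = s - d - j common vertices of V and uses
  at least 3d + j exclusive vertices of U (so j <= d); concavity of
  (s - d - j)(3d + j) and 3d < s show that it is strictly more expensive. All
  gaps being strict and all weights positive, the two cones meet in a
  neighbourhood of this weight in the hyperplane <c, x_S> = <c, x_T>, so they are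
  adjacent. Since 2k <= 3n < 4k, the floor in the asymptotic bound
  is 1. *)
Require Import Defs.
From HB Require Import structures.
From mathcomp Require Import all_boot all_order all_algebra.
From mathcomp Require Import finmap zify ring lra.
From mathcomp Require Import boolp classical_sets reals.

Set Implicit Arguments.
Unset Strict Implicit.
Unset Printing Implicit Defensive.

Import Order.TTheory GRing.Theory Num.Theory.
Local Open Scope ring_scope.

(** * Integer edge weights and the bicliques that minimise them *)

Section Weights.
Variables (n : nat).
Implicit Types (A B : {set 'I_n}) (w : 'I_n -> 'I_n -> nat).

Definition cost w A B : nat := (\sum_(i in A) \sum_(j in B) w i j)%N.

Lemma cost_ge_entry w A B i j : i \in A -> j \in B -> (w i j <= cost w A B)%N.
Proof.
move=> iA jB; rewrite /cost (bigD1 i) //= (bigD1 j) //= -addnA; exact: leq_addr.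
Qed.

(* M is charged outside the union of the bicliques A1 x B1 and A2 x B2. *)
Definition corner_weight A1 A2 B1 B2 (L M : nat) (i j : 'I_n) : nat :=
  if (i \in A1) && (j \in B1) || (i \in A2) && (j \in B2) then
    if ~~ ((i \in A1) && (i \in A2)) && ((j \in B1) && (j \in B2)) then L else 1%N
  else M.

Lemma corner_weightC A1 A2 B1 B2 L M :
  corner_weight A1 A2 B1 B2 L M =2 corner_weight A2 A1 B2 B1 L M.
Proof.
move=> i j; rewrite /corner_weight orbC.
by rewrite (andbC (i \in A1) (i \in A2)) (andbC (j \in B1) (j \in B2)).
Qed.

Lemma sum_card_setD A B (l : nat) :
  (\sum_(i in A) (i \notin B) * l = #|A :\: B| * l)%N.
Proof.
rewrite -big_distrl /= -sum1_card [in RHS](eq_bigl (fun i => (i \in A) && (i \notin B))).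
  by rewrite big_mkcondr.
by move=> i; rewrite !inE andbC.
Qed.

Lemma sum_card_setI A B (l : nat) :
  (\sum_(i in A) (i \in B) * l = #|A :&: B| * l)%N.
Proof.
rewrite -big_distrl /= -sum1_card [in RHS](eq_bigl (fun i => (i \in A) && (i \in B))).
  by rewrite big_mkcondr.
by move=> i; rewrite !inE.
Qed.

(** Each edge contributes 1, and the heavy ones, from [A1 :\: A2] to [B1 :&: B2], contribute [L]
    more. *)
Lemma cost_corner A1 A2 B1 B2 L M :
  cost (corner_weight A1 A2 B1 B2 L.+1 M) A1 B1 =
  (#|A1| * #|B1| + #|A1 :\: A2| * (#|B1 :&: B2| * L))%N.
Proof.
rewrite -sum_nat_const -sum_card_setD -big_split /=.
apply: eq_bigr => i iA1.
rewrite -sum1_card -sum_card_setI big_distrr -big_split /=.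
apply: eq_bigr => j jB1.
rewrite /corner_weight iA1 jB1 /=.
by case: (i \in A2); case: (j \in B2); rewrite /= ?mul1n ?mul0n ?add1n ?addn0.
Qed.

Lemma subset_card_eq A B A' B' :
  A \subset A' -> B \subset B' -> (#|A| + #|B| = #|A'| + #|B'|)%N ->
  (A, B) = (A', B').
Proof.
move=> sA sB e.
have h1 : (#|A| <= #|A'|)%N by exact: subset_leq_card.
have h2 : (#|B| <= #|B'|)%N by exact: subset_leq_card.
have -> : A = A' by apply/eqP; rewrite eqEcard sA -(leq_add2r #|B|) e leq_add2l.
by have -> : B = B' by apply/eqP; rewrite eqEcard sB -(leq_add2l #|A|) e leq_add2r.
Qed.

(** Each side has at most [n] vertices, so neither can be empty. Hence every vertex of such a
    biclique lies on one of its edges, and a misplaced vertex is charged. *)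
Lemma gt_card_neq0 k A B : (n < k)%N -> (#|A| + #|B| = k)%N ->
  A != finset.set0 /\ B != finset.set0.
Proof.
move=> nk e; rewrite -!card_gt0.
have h (C : {set 'I_n}) : (#|C| <= n)%N by rewrite -[leqRHS]card_ord; exact: max_card.
by have := h A; have := h B; split; lia.
Qed.

Lemma corner_weight_gt0 A1 A2 B1 B2 L M i j :
  (0 < corner_weight A1 A2 B1 B2 L.+1 M.+1 i j)%N.
Proof. by rewrite /corner_weight; case: ifP => _ //; case: ifP. Qed.

(** Here [b] stands for |B| and [q] for the number of vertices of A outside the common part. With j
    = s - d - b, the hypotheses give q >= 3d + j and j <= d. Then (3d + j)b - 2d(s - d) = (d + j)b -
    2dj, and b > 2d - j makes this exceed (2d + j)(d - j) >= 0. *)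
Lemma corner_quadratic (s d b q : nat) :
  (0 < d)%N -> (3 * d < s)%N -> (b <= s - d)%N -> (q <= 4 * d)%N ->
  (3 * s <= 2 * (s - d) + q + b)%N -> (2 * d * (s - d) < q * b)%N.
Proof.
move=> d0 ds bs qd h.
have [j ej] : exists j, (b + d + j = s)%N by exists (s - d - b)%N; lia.
have hj : (j <= d)%N by lia.
have hq : (3 * d + j <= q)%N by lia.
have -> : (s - d = b + j)%N by lia.
apply: (@leq_trans ((3 * d + j) * b)); last by rewrite leq_mul2r hq orbT.
have hb : (d + j < b + 2 * j)%N by lia.
nia.
Qed.

Lemma mul_succ_gt (a l : nat) : (l + a * l < a.+1 * l.+1)%N.
Proof. by rewrite mulSn mulnS; lia. Qed.

Lemma corner_unique_min (s d : nat) A1 A2 B1 B2 :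
    (n < 3 * s)%N -> (0 < d)%N -> (3 * d < s)%N ->
    #|A1| = (2 * s)%N -> #|A2| = (2 * s)%N -> #|B1| = s -> #|B2| = s ->
    #|A1 :&: A2| = (2 * (s - d))%N -> #|B1 :&: B2| = (s - d)%N ->
  exists w, [/\ forall i j, (0 < w i j)%N, cost w A1 B1 = cost w A2 B2 &
    forall A B, (#|A| + #|B| = 3 * s)%N -> (A, B) != (A1, B1) ->
      (A, B) != (A2, B2) -> (cost w A1 B1 < cost w A B)%N].
Proof.
move=> ns d0 ds cA1 cA2 cB1 cB2 cA cB.
have cD1 : #|A1 :\: A2| = (2 * d)%N.
  by have := cardsID A2 A1; lia.
have cD2 : #|A2 :\: A1| = (2 * d)%N.
  by have := cardsID A1 A2; rewrite finset.setIC; lia.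
have cUA : #|A1 :|: A2| = (2 * s + 2 * d)%N by rewrite cardsU; lia.
have cUB : #|B1 :|: B2| = (s + d)%N by rewrite cardsU; lia.
(* [L] is |A1| |B1|, so one additional heavy edge outweighs the lower order term. [M] is the common
   cost of the two bicliques, so a single edge of weight [M.+1] is already too expensive. *)
pose L := (2 * s * s)%N.
pose M := (2 * s * s + 2 * d * ((s - d) * L))%N.
pose w := corner_weight A1 A2 B1 B2 L.+1 M.+1.
have e1 : cost w A1 B1 = M by rewrite cost_corner cD1 cA1 cB1 cB.
have e2 : cost w A2 B2 = M.
  transitivity (cost (corner_weight A2 A1 B2 B1 L.+1 M.+1) A2 B2).
    by apply: eq_bigr => i _; apply: eq_bigr => j _; exact: corner_weightC.
  by rewrite cost_corner cD2 cA2 cB2 finset.setIC cB.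
exists w; split; [by move=> *; exact: corner_weight_gt0 | by rewrite e1 e2 |].
move=> A B cAB ne1 ne2; rewrite e1.
have [/existsP[i /existsP[j /and3P[iA jB ij]]]|] :=
  boolP [exists i, exists j, [&& i \in A, j \in B &
     ~~ ((i \in A1) && (j \in B1) || (i \in A2) && (j \in B2))]].
  apply: leq_trans _ (cost_ge_entry w iA jB).
  by rewrite /w /corner_weight (negPf ij).
rewrite negb_exists => /forallP nG.
have {nG} G i j : i \in A -> j \in B ->
    (i \in A1) && (j \in B1) || (i \in A2) && (j \in B2).
  move=> iA jB; have := nG i; rewrite negb_exists => /forallP/(_ j).
  by rewrite iA jB /= negbK.
have [/set0Pn[a0 a0A] /set0Pn[b0 b0B]] := gt_card_neq0 ns cAB.
have AU : A \subset A1 :|: A2.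
  by apply/fintype.subsetP => i iA; have := G i _ iA b0B; rewrite inE; do 2!case: (i \in _).
have BU : B \subset B1 :|: B2.
  apply/fintype.subsetP => j jB; have := G _ j a0A jB; rewrite inE.
  by case: (j \in B1); case: (j \in B2); rewrite ?andbF.
(* A subset of A1 :&: A2 leaves room for at most 3s - d vertices. *)
have notI : ~ A \subset A1 :&: A2.
  move=> /subset_leq_card; have := subset_leq_card BU.
  by rewrite cA cUB; move: cAB d0 ds; clear; lia.
have [sA1|] := boolP (A \subset A1).
  have sB1 : B \subset B1.
    apply/fintype.subsetP => j jB; apply/negPn/negP => jB1; apply: notI.
    apply/fintype.subsetP => i iA; have := G _ _ iA jB.
    by rewrite (negPf jB1) andbF /= inE (fintype.subsetP sA1 _ iA) => /andP[].
  by move: ne1; rewrite (subset_card_eq sA1 sB1) ?eqxx // cAB cA1 cB1; clear; lia.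
have [sA2|] := boolP (A \subset A2).
  have sB2 : B \subset B2.
    apply/fintype.subsetP => j jB; apply/negPn/negP => jB2; case: notI.
    apply/fintype.subsetP => i iA; have := G _ _ iA jB.
    by rewrite (negPf jB2) andbF orbF /= inE (fintype.subsetP sA2 _ iA) andbT => /andP[].
  by move: ne2; rewrite (subset_card_eq sA2 sB2) ?eqxx // cAB cA2 cB2; clear; lia.
move=> /subsetPn[a2 a2A a2N] /subsetPn[a1 a1A a1N].
(* A has vertices outside A1 and outside A2, which forces B into the common part. *)
have sB : B \subset B1 :&: B2.
  apply/fintype.subsetP => j jB; rewrite inE.
  have := G _ _ a1A jB; have := G _ _ a2A jB.
  by rewrite (negPf a2N) (negPf a1N) /= orbF => /andP[_ ->] /andP[_ ->].
(* A vertex of A outside the common part is joined to B by heavy edges only. *)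
have lb : (#|A :\: (A1 :&: A2)| * (#|B| * L.+1) <= cost w A B)%N.
  rewrite -sum_card_setD; apply: leq_sum => i iA.
  rewrite -sum_nat_const big_distrr /=; apply: leq_sum => j jB.
  have := fintype.subsetP sB _ jB; rewrite !inE => /andP[j1 j2].
  have := fintype.subsetP AU _ iA; rewrite /w /corner_weight !inE j1 j2 /= !andbT.
  by case: (i \in A1); case: (i \in A2); rewrite /= ?mul1n ?mul0n.
apply: leq_trans _ lb.
have := subset_leq_card sB; rewrite cB => hb.
have := cardsID (A1 :&: A2) A; have := subset_leq_card (finset.subsetIr A (A1 :&: A2)).
rewrite cA => h1 h2.
(* The bound is the size of the symmetric difference of [A1] and [A2]. *)
have h3 : (#|A :\: (A1 :&: A2)| <= 4 * d)%N.
  have -> : (4 * d = #|(A1 :|: A2) :\: (A1 :&: A2)|)%N.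
    have := cardsID (A1 :&: A2) (A1 :|: A2).
    have /finset.setIidPr -> : A1 :&: A2 \subset A1 :|: A2.
      exact: fintype.subset_trans (finset.subsetIl _ _) (finset.subsetUl _ _).
    by rewrite cA cUA; move: ds; clear; lia.
  by apply: subset_leq_card; exact: finset.setSD.
have := @corner_quadratic s d #|B| #|A :\: (A1 :&: A2)| d0 ds hb h3.
move=> /(_ ltac:(move: cAB h2 h1; clear; lia)) hq.
rewrite mulnA; apply: (@leq_trans ((2 * d * (s - d)).+1 * L.+1)).
  by rewrite /M mulnA; exact: mul_succ_gt.
by rewrite leq_mul2r hq orbT.
Qed.

End Weights.

(** * The cones of minimised weights and the dimension of their intersections *)

Section Cones.
Variables (R : realType) (n : nat).
Implicit Types (A B : {set 'I_n}) (w : 'I_n -> 'I_n -> nat) (c x y : 'M[R]_n).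

Lemma inner_biclique c A B :
  inner c (biclique_vec R A B) = \sum_(i in A) \sum_(j in B) c i j.
Proof.
rewrite /inner [RHS]big_mkcond; apply: eq_bigr => i _.
case: ifP => iA; last by apply: big1 => j _; rewrite mxE iA mulr0.
rewrite [RHS]big_mkcond; apply: eq_bigr => j _.
by rewrite mxE iA /=; case: (j \in B); rewrite ?mulr1 ?mulr0.
Qed.

Definition weight_mx w : 'M[R]_n := \matrix_(i, j) (w i j)%:R.

Lemma inner_weight w A B :
  inner (weight_mx w) (biclique_vec R A B) = (cost w A B)%:R.
Proof.
rewrite inner_biclique /cost natr_sum; apply: eq_bigr => i _.
by rewrite natr_sum; apply: eq_bigr => j _; rewrite mxE.
Qed.

Lemma XuP k x :
  reflect (exists A B, (#|A| + #|B| = k)%N /\ x = biclique_vec R A B)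
    (x \in Xu R n k).
Proof.
apply: (iffP (imfsetP _ _ _ _)) => [[[A B] /= /eqP h ->]|[A [B [h ->]]]].
  by exists A, B.
by exists (A, B) => //=; apply/eqP.
Qed.

(** The vertices of the graph are cones, so distinct bicliques must be shown to have distinct cones.
    A weight whose only minimiser is the first biclique lies in one cone and not in the other. *)
Lemma Kmin_inj k A1 B1 A2 B2 : (n < k)%N ->
  (#|A1| + #|B1| = k)%N -> (#|A2| + #|B2| = k)%N ->
  Kmin k (biclique_vec R A1 B1) = Kmin k (biclique_vec R A2 B2) ->
  (A1, B1) = (A2, B2).
Proof.
move=> nk k1 k2 eK; apply/eqP/negPn/negP => ne.
pose M := (#|A1| * #|B1|)%N.
(* Charging more than |A1| |B1| outside x makes x the unique minimizer. *)
pose w (i j : 'I_n) := if (i \in A1) && (j \in B1) then 1%N else M.+1.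
have e1 : cost w A1 B1 = M.
  rewrite /cost /M -sum_nat_const; apply: eq_bigr => i iA.
  by rewrite -sum1_card; apply: eq_bigr => j jB; rewrite /w iA jB.
have gt A B : (#|A| + #|B| = k)%N -> (A1, B1) != (A, B) -> (M < cost w A B)%N.
  move=> h neA; have [/set0Pn[a0 a0A] /set0Pn[b0 b0B]] := gt_card_neq0 nk h.
  have [sA|/subsetPn[i iA iN]] := boolP (A \subset A1); last first.
    by apply: leq_trans _ (cost_ge_entry w iA b0B); rewrite /w (negPf iN).
  have [sB|/subsetPn[j jB jN]] := boolP (B \subset B1); last first.
    by apply: leq_trans _ (cost_ge_entry w a0A jB); rewrite /w (negPf jN) andbF.
  by move: neA; rewrite (subset_card_eq sA sB) ?eqxx // h.
have : Kmin k (biclique_vec R A1 B1) (weight_mx w).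
  split=> [i j|y /XuP[A [B [h ->]]]]; first by rewrite mxE ler0n.
  rewrite !inner_weight ler_nat e1.
  by have [[<- <-]|/eqP/(gt _ _ h)/ltnW//] := (A1, B1) =P (A, B); rewrite e1.
rewrite eK => -[_ /(_ (biclique_vec R A1 B1)) h].
have xX : biclique_vec R A1 B1 \in Xu R n k by apply/XuP; exists A1, B1.
by have := h xX; rewrite !inner_weight ler_nat e1 leqNgt gt.
Qed.

(** The codomain [R^o] is a vector space, which makes [linfun] and its kernel available. *)
Definition inner_form x : 'M[R]_n -> R^o := fun c => inner c x.

Lemma inner_form_is_linear x : linear (inner_form x).
Proof.
move=> a c c'; rewrite /inner_form /inner /= scaler_sumr -big_split /=.
apply: eq_bigr => i _; rewrite scaler_sumr -big_split /=.
by apply: eq_bigr => j _; rewrite !mxE mulrDl -mulrA.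
Qed.

HB.instance Definition _ x :=
  GRing.isLinear.Build R 'M[R]_n R^o *:%R (inner_form x) (inner_form_is_linear x).

Lemma innerBr c x y : inner c (x - y) = inner c x - inner c y.
Proof.
rewrite /inner -sumrB; apply: eq_bigr => i _; rewrite -sumrB.
by apply: eq_bigr => j _; rewrite !mxE mulrBr.
Qed.

(** Rank-nullity: the image is all of the line, because the form at [x] itself is a sum of
    squares. *)
Lemma dim_lker_inner_form x : x != 0 ->
  \dim (lker (linfun (inner_form x))) = (n ^ 2 - 1)%N.
Proof.
move=> x0; have := limg_ker_dim (linfun (inner_form x)) fullv.
rewrite capfv dimvf dim_matrix.
have -> : \dim (limg (linfun (inner_form x))) = 1%N.
  apply/eqP; rewrite eqn_leq; apply/andP; split.
    by have := dimvS (subvf (limg (linfun (inner_form x)))); rewrite dimvf.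
  rewrite lt0n dimv_eq0; apply/negP => /eqP h.
  have xx : inner x x = 0.
    have : linfun (inner_form x) x \in limg (linfun (inner_form x)).
      by apply: memv_img; exact: memvf.
    by rewrite h memv0 lfunE => /eqP.
  case/negP: x0; apply/eqP/matrixP => i j; rewrite mxE.
  have sq a b : 0 <= x a b * x a b by rewrite -expr2 sqr_ge0.
  have xi : \sum_l x i l * x i l = 0.
    by apply: psumr_eq0P xx i erefl => a _; apply: sumr_ge0 => b _.
  have /eqP : x i j * x i j = 0 by apply: psumr_eq0P xi j erefl => b _.
  by rewrite mulf_eq0 orbb => /eqP.
by move=> h; rewrite -mulnn; have <- : _ = (n * n)%N := h; rewrite addnK.
Qed.

Lemma inner_biclique_bound c A B :
  `|inner c (biclique_vec R A B)| <= \sum_i \sum_j `|c i j|.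
Proof.
apply: le_trans (ler_norm_sum _ _ _) _; apply: ler_sum => i _.
apply: le_trans (ler_norm_sum _ _ _) _; apply: ler_sum => j _.
by rewrite normrM mxE normr_nat ler_piMr // lern1 leq_b1.
Qed.

(** Points of both cones tie [x] and [y], so the affine hull lies in the hyperplane orthogonal to
    [x - y]. Conversely, a short enough move from [w] towards any [v] of that hyperplane stays in
    both cones, and [v] is on the line through the two points. *)
Lemma has_dim_Kmin_cap k w A1 B1 A2 B2 :
    (#|A1| + #|B1| = k)%N -> (#|A2| + #|B2| = k)%N ->
    biclique_vec R A1 B1 != biclique_vec R A2 B2 ->
    (forall i j, 0 < w i j)%N -> cost w A1 B1 = cost w A2 B2 ->
    (forall A B, (#|A| + #|B| = k)%N -> (A, B) != (A1, B1) ->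
      (A, B) != (A2, B2) -> (cost w A1 B1 < cost w A B)%N) ->
  has_dim (Kmin k (biclique_vec R A1 B1) `&` Kmin k (biclique_vec R A2 B2))%classic
    (n ^ 2 - 1).
Proof.
set x := biclique_vec R A1 B1; set y := biclique_vec R A2 B2.
move=> k1 k2 nxy w0 we wmin.
exists 0, (lker (linfun (inner_form (x - y)))); split; last first.
  by apply: dim_lker_inner_form; rewrite subr_eq0.
have xX : x \in Xu R n k by apply/XuP; exists A1, B1.
have yX : y \in Xu R n k by apply/XuP; exists A2, B2.
apply/seteqP; split=> v /=.
  move=> [r [a [p [pK _ ->]]]]; rewrite subr0.
  apply: rpred_sum => i _; apply: rpredZ; rewrite memv_ker lfunE /= /inner_form.
  have [[_ /(_ _ yX) h1] [_ /(_ _ xX) h2]] := pK i.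
  by rewrite innerBr subr_eq0 eq_le h1 h2.
rewrite subr0 memv_ker lfunE /= /inner_form innerBr subr_eq0 => /eqP vxy.
pose c0 := weight_mx w; pose u := v - c0.
have innerDZ (a : R) b c z : inner (c + a *: b) z = inner c z + a * inner b z.
  by rewrite addrC [LHS](inner_form_is_linear z) addrC.
have uxy : inner u x = inner u y.
  by rewrite /u -scaleN1r !innerDZ vxy !inner_weight we.
pose N := \sum_i \sum_j `|u i j|.
have N0 : 0 <= N by apply: sumr_ge0 => i _; apply: sumr_ge0.
(* Weights and cost gaps are positive integers, hence at least 1, while moving by [t *: u] changes a
   difference of two costs by at most 2tN <= 1. The summand 1 keeps the inverse meaningful when [N]
   is 0. *)
pose t := (2 * N + 1)^-1.
have t0 : 0 < t by rewrite invr_gt0; lra.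
have tN : t * (2 * N) <= 1.
  by rewrite mulrC ler_pdivrMr ?mul1r; lra.
have key : (Kmin k x `&` Kmin k y)%classic (c0 + t *: u).
  have pos i j : 0 <= (c0 + t *: u) i j.
    rewrite !mxE; have wij : 1 <= (w i j)%:R :> R by rewrite ler1n.
    have uN : `|v i j - (w i j)%:R| <= N.
      rewrite /N (bigD1 i) //= (bigD1 j) //= /u !mxE -addrA lerDl.
      by apply: addr_ge0; apply: sumr_ge0 => // l _; apply: sumr_ge0.
    have := ler_norm (- (v i j - (w i j)%:R)); rewrite normrN => h.
    have : t * (- (v i j - (w i j)%:R)) <= t * (2 * N).
      by rewrite ler_pM2l //; lra.
    by lra.
  have exy : inner (c0 + t *: u) x = inner (c0 + t *: u) y.
    by rewrite !innerDZ uxy !inner_weight we.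
  have minx z : z \in Xu R n k -> inner (c0 + t *: u) x <= inner (c0 + t *: u) z.
    move=> /XuP[A [B [h ->]]].
    have [[-> ->]//|/eqP ne1] := (A, B) =P (A1, B1).
    have [[-> ->]|/eqP ne2] := (A, B) =P (A2, B2); first by rewrite exy.
    have := wmin _ _ h ne1 ne2; rewrite !innerDZ !inner_weight -(ler_nat R).
    rewrite -[in X in X -> _]natr1 => hc.
    have := inner_biclique_bound u A B; have := inner_biclique_bound u A1 B1.
    rewrite -/N -/x !ler_norml => /andP[b1 b2] /andP[b3 b4].
    have : t * (inner u x - inner u (biclique_vec R A B)) <= t * (2 * N).
      by rewrite ler_pM2l //; lra.
    by lra.
  by split; split=> // z zX; rewrite -?exy; exact: minx.
have c0K : (Kmin k x `&` Kmin k y)%classic c0.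
  split; split=> [i j|z /XuP[A [B [h ->]]]]; rewrite ?mxE ?ler0n //;
    rewrite !inner_weight ler_nat -?we;
    (have [[-> ->]//|/eqP ne1] := (A, B) =P (A1, B1));
    (have [[-> ->]|/eqP ne2] := (A, B) =P (A2, B2); first by rewrite we);
    exact: ltnW (wmin _ _ h ne1 ne2).
(* v is the affine combination (1 - 1/t) c0 + (1/t) (c0 + t u). *)
exists 2%N, (fun i : 'I_2 => if val i == 0%N then 1 - t^-1 else t^-1),
  (fun i : 'I_2 => if val i == 0%N then c0 else c0 + t *: u); split.
- by move=> i; case: ifP.
- by rewrite !big_ord_recl big_ord0 /=; lra.
- rewrite !big_ord_recl big_ord0 /= addr0 scalerDr scalerA mulVf ?gt_eqF //.
  by rewrite scale1r scalerBl scale1r addrA subrK /u addrC subrK.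
Qed.

End Cones.

(** * A clique indexed by the s-subsets of an m-set *)

Section Clique.
Variables (n m s : nat).
Hypothesis mn : (2 * m <= n)%N.

Lemma copy_subproof (p : 'I_m * bool) : (p.1 + p.2 * m < n)%N.
Proof. by case: p => -[i im] []; rewrite /=; lia. Qed.

(** The flag selects one of two disjoint blocks of [m] indices, so one injection serves both sides:
    U uses both flags, V only [true]. *)
Definition copy (p : 'I_m * bool) : 'I_n := Ordinal (copy_subproof p).

Lemma copy_inj : injective copy.
Proof.
move=> [[i im] b] [[j jm] b'] /(congr1 val) /= e.
have [eb eij] : b = b' /\ i = j by case: b b' e => [] [] /=; lia.
by rewrite eb; congr pair; apply: val_inj.
Qed.

Definition clique_fst (S : {set 'I_m}) : {set 'I_n} :=
  copy @: finset.setX S [set: bool].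
Definition clique_snd (S : {set 'I_m}) : {set 'I_n} :=
  copy @: finset.setX S [set true].

Lemma card_clique_fst S : #|clique_fst S| = (2 * #|S|)%N.
Proof. by rewrite (card_imset _ copy_inj) cardsX cardsT card_bool mulnC. Qed.

Lemma card_clique_snd S : #|clique_snd S| = #|S|.
Proof. by rewrite (card_imset _ copy_inj) cardsX cards1 muln1. Qed.

Lemma setX_setI (T : finType) (S S' : {set 'I_m}) (D : {set T}) :
  finset.setX S D :&: finset.setX S' D = finset.setX (S :&: S') D.
Proof. by apply/setP => -[i b]; rewrite !inE; do 3!case: (_ \in _). Qed.

Lemma clique_fstI S S' : clique_fst S :&: clique_fst S' = clique_fst (S :&: S').
Proof.
by rewrite /clique_fst -(imsetI (in2W copy_inj)) setX_setI.
Qed.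

Lemma clique_sndI S S' : clique_snd S :&: clique_snd S' = clique_snd (S :&: S').
Proof.
by rewrite /clique_snd -(imsetI (in2W copy_inj)) setX_setI.
Qed.

Lemma clique_snd_inj : injective clique_snd.
Proof.
move=> S S' e; apply/setP => i.
have h (T : {set 'I_m}) : (i \in T) = (copy (i, true) \in clique_snd T).
  by rewrite (mem_imset _ _ copy_inj) !inE eqxx andbT.
by rewrite !h e.
Qed.

Variable R : realType.
Hypotheses (ms : (3 * m < 4 * s)%N) (ns : (n < 3 * s)%N).

Let vec S := biclique_vec R (clique_fst S) (clique_snd S).

Lemma card_clique_vec (S : {set 'I_m}) : #|S| = s ->
  (#|clique_fst S| + #|clique_snd S| = 3 * s)%N.
Proof. by rewrite card_clique_fst card_clique_snd => ->; lia. Qed.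

Lemma clique_vec_Xu (S : {set 'I_m}) : #|S| = s -> vec S \in Xu R n (3 * s).
Proof.
by move=> h; apply/XuP; exists (clique_fst S), (clique_snd S); rewrite card_clique_vec.
Qed.

Lemma clique_Kmin_inj (S S' : {set 'I_m}) : #|S| = s -> #|S'| = s ->
  Kmin (3 * s) (vec S) = Kmin (3 * s) (vec S') -> S = S'.
Proof.
move=> h h' e.
have [_] := Kmin_inj ns (card_clique_vec h) (card_clique_vec h') e.
exact: clique_snd_inj.
Qed.

Lemma clique_has_dim (S S' : {set 'I_m}) : #|S| = s -> #|S'| = s -> S != S' ->
  has_dim (Kmin (3 * s) (vec S) `&` Kmin (3 * s) (vec S'))%classic (n ^ 2 - 1).
Proof.
move=> h h' ne.
have nv : vec S != vec S'.
  apply: contra ne => /eqP e; apply/eqP/clique_Kmin_inj => //.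
  by rewrite e.
have : (#|S :|: S'| <= m)%N by rewrite -[leqRHS]card_ord; exact: max_card.
rewrite cardsU h h' => hU.
have hI : (#|S :&: S'| < s)%N.
  rewrite ltnNge; apply/negP => hs; case/negP: ne.
  have e1 : S :&: S' == S by rewrite eqEcard finset.subsetIl h.
  have e2 : S :&: S' == S' by rewrite eqEcard finset.subsetIr h'.
  by rewrite -{1}(eqP e1) {1}(eqP e2).
(* This is |S \ S'|. The union has s + d <= m elements, so 3d <= 3m - 3s < s. *)
pose d := (s - #|S :&: S'|)%N.
have [d0 ds ed] : [/\ (0 < d)%N, (3 * d < s)%N & (#|S :&: S'| = s - d)%N].
  by rewrite /d; move: hI hU ms; clear; split; lia.
have [w [w0 we wmin]] := @corner_unique_min n s d
  (clique_fst S) (clique_fst S') (clique_snd S) (clique_snd S') ns d0 ds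
  ltac:(by rewrite card_clique_fst h) ltac:(by rewrite card_clique_fst h')
  ltac:(by rewrite card_clique_snd h) ltac:(by rewrite card_clique_snd h')
  ltac:(by rewrite clique_fstI card_clique_fst ed)
  ltac:(by rewrite clique_sndI card_clique_snd ed).
exact: has_dim_Kmin_cap (card_clique_vec h) (card_clique_vec h') nv w0 we wmin.
Qed.

(** The s-subsets inject into the vertices of the graph, and their images are pairwise adjacent. *)
Lemma binom_le_omega_Kmin : ('C(m, s) <= omega_Kmin R n (3 * s))%N.
Proof.
pose sT := {S : {set 'I_m} | #|S| == s}.
have sTs (S : sT) : #|val S| = s by apply/eqP; exact: (valP S).
have in_cones (S : sT) : Kmin (3 * s) (vec (val S)) \in Kmin_cones R n (3 * s).
  by apply/imfsetP; exists (vec (val S)) => //; exact: clique_vec_Xu.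
pose F (S : sT) : Kmin_cones R n (3 * s) := FSetSub (in_cones S).
have F_inj : injective F.
  move=> S S' /(congr1 val) /= e; apply: val_inj.
  exact: clique_Kmin_inj (sTs S) (sTs S') e.
have -> : 'C(m, s) = #|F @: [set: sT]|.
  rewrite card_imset // cardsT card_sig -[in LHS](card_ord m) -card_draws.
  by apply: eq_card => S; rewrite !inE.
apply: leq_bigmax_cond (fun Q : {set Kmin_cones R n (3 * s)} => #|Q|) _ _.
apply/forallP => C; apply/implyP => /imsetP[S _ ->].
apply/forallP => D; apply/implyP => /imsetP[S' _ ->].
apply/implyP => ne; apply/asboolP.
have neS : val S != val S'.
  by apply: contra ne => /eqP/val_inj ->.
exists (vec (val S)), (vec (val S')); split; split=> //; try exact: clique_vec_Xu.
  by apply: contra neS => /eqP e; apply/eqP/clique_Kmin_inj => //; rewrite e.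
exact: clique_has_dim.
Qed.

End Clique.

(** * The clique bound and its asymptotic form *)

Theorem theorem7 (R : realType) :
  exists C : R, 0 < C /\
    forall n k m s : nat,
      (1 <= n)%N -> (1 <= k)%N -> (k <= 2 * n)%N ->
      m = (n %/ 2)%N -> k = (3 * s)%N ->
      9 / 4 * m%:R < k%:R :> R -> (k < 3 * m)%N ->
      ('C(m, s) <= omega_Kmin R n k)%N /\
      C * ((3 * n) %/ (2 * k))%N%:R ^+ (k %/ 3)%N <= 'C(m, s)%:R.
Proof.
exists 1; split=> [//|n k m s n1 k1 k2n em ek hR km].
have {hR} h : (9 * m < 4 * k)%N.
  rewrite -(ltr_nat R) !natrM; lra.
have hn : (n <= 2 * m + 1)%N by lia.
split.
  (* The condition n < 3s: for m >= 4, n <= 2m + 1 <= 9m/4 < k; for smaller m no multiple of 3 lies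
     strictly between 9m/4 and 3m. *)
  by rewrite ek; apply: binom_le_omega_Kmin; lia.
rewrite mul1r -natrX ler_nat.
apply: (@leq_trans 1%N); last by rewrite bin_gt0; lia.
(* Since 3n <= 6m + 3 < 4k, the base is at most 1, so its power is at most 1 and the constant 1
   suffices. *)
have : ((3 * n) %/ (2 * k) <= 1)%N by rewrite -ltnS ltn_divLR; lia.
case: ((3 * n) %/ (2 * k))%N => [|[|q]] // _; last by rewrite exp1n.
by case: (k %/ 3)%N => [|e] //; rewrite exp0n.
Qed.
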